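(* The smallest integer greater than $1$ which cannot be represented as a sum of two squares and at most two powers of $2$ is $535903$. Moreover, for every integer $\alpha \geq 0$, the integer $2^{\alpha} \times 1151121374334$ cannot be represented as a sum of two squares and at most two powers of $2$.
   Context: ''Squares'' means squares of integers (so $0$ is allowed), and ''powers of $2$'' means numbers $2^a$ with $a$ a non-negative integer. An integer $n$ is a sum of two squares and at most two powers of $2$ if there exist integers $x,y$ such that $n = x^2+y^2$, or $n = x^2+y^2+2^a$ for some integer $a\ge 0$, or $n = x^2+y^2+2^a+2^b$ for some integers $a,b\ge 0$ (with $a=b$ allowed). *)

(* Defs.v *)
From Stdlib Require Import ZArith.
Open Scope Z_scope.

(* The powers of 2 are guarded by [0 <= a] because [Z.pow] with a negative
   exponent is 0. *)
Definition two_squares_two_powers (n : Z) : Prop :=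
  (exists x y : Z, n = x ^ 2 + y ^ 2) \/
  (exists x y a : Z, 0 <= a /\ n = x ^ 2 + y ^ 2 + 2 ^ a) \/
  (exists x y a b : Z,
      0 <= a /\ 0 <= b /\ n = x ^ 2 + y ^ 2 + 2 ^ a + 2 ^ b).

Definition is_smallest (P : Z -> Prop) (m : Z) : Prop :=
  P m /\ forall n : Z, P n -> m <= n.

(* Main.v *)
Require Import Defs.
From Stdlib Require Import ZArith Lia List Bool MSetPositive Zwf.
Open Scope Z_scope.

(** Why the theorem is true.

    A number is kept from being a sum of two squares by a divisor [d] with
    [d mod 4 = 3] that is coprime to its cofactor: such a [d] contains a prime
    congruent to 3 mod 4 to an odd power.  The lemma
    [not_sum_of_two_squares_of_coprime_divisor] proves this for an arbitrary
    such [d], by a descent that never mentions primes, so that a certificate of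
    non-representability is one small integer [d] and needs no primality proof.

    If [n < 2 ^ (L + 1)], then [n] is a sum of two squares and at most two
    powers of 2 exactly when [n - t] is a sum of two squares for some [t] in the
    finite list [pow2_sums L].  This makes the failure of 535903 and of
    [m = 1151121374334] finite: each difference has a certificate, which is either
    its whole odd part or a member of a short list of values of [d].

    The failure passes from [n] to [2 n] when 18 divides [n]
    ([not_two_squares_two_powers_double]), which gives the whole family
    [2 ^ alpha * m].  A representation of [2 n] with only even powers of 2 can
    be halved, because [2 k] is a sum of two squares only if [k] is.  One that
    uses the odd power [2 ^ 0] leaves, when it cannot be halved, either a number
    congruent to 3 mod 4 or the number [2 n - 3], which is exactly divisible
    by 3.

    Conversely the representable numbers are closed under doubling, so that below
    535903 only the odd ones have to be represented.  This is a computation: the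
    small sums of one square and at most two powers of 2 are stored in a binary
    trie, and for each odd [n] the differences [n - x ^ 2] are looked up, from the
    largest square down, until one is found.  These small sums are so dense that
    two lookups are enough on average. *)

(** * Obstructions to being a sum of two squares *)

Definition sum_of_two_squares (n : Z) : Prop := exists x y : Z, n = x ^ 2 + y ^ 2.

Lemma centered_residue (d x : Z) : 0 < d -> exists k, 2 * Z.abs (x - d * k) <= d.
Proof.
  intros Hd. exists ((2 * x + d) / (2 * d)).
  pose proof (Z.div_mod (2 * x + d) (2 * d) ltac:(lia)).
  pose proof (Z.mod_pos_bound (2 * x + d) (2 * d) ltac:(lia)).
  lia.
Qed.

Lemma square_le_scaled (g x : Z) : 0 < g -> x ^ 2 <= (g * x) ^ 2.
Proof.
  intros Hg. rewrite Z.pow_mul_l, !Z.pow_2_r.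
  pose proof (Z.square_nonneg x). assert (1 <= g * g) by nia. nia.
Qed.

Lemma square_le_of_half_abs (d x : Z) : 2 * Z.abs x <= d -> 4 * x ^ 2 <= d * d.
Proof.
  intros H. rewrite Z.pow_2_r, <- (Z.abs_square x).
  pose proof (Z.abs_nonneg x). nia.
Qed.

Lemma factor_gcd (x y : Z) :
  ~ (x = 0 /\ y = 0) ->
  exists x' y', x = Z.gcd x y * x' /\ y = Z.gcd x y * y' /\ Z.gcd x' y' = 1.
Proof.
  intros Hxy.
  assert (Hg : Z.gcd x y <> 0) by (rewrite Z.gcd_eq_0; exact Hxy).
  exists (x / Z.gcd x y), (y / Z.gcd x y). repeat split.
  - apply Z_div_exact_full_2, Z.mod_divide, Z.gcd_divide_l; exact Hg.
  - apply Z_div_exact_full_2, Z.mod_divide, Z.gcd_divide_r; exact Hg.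
  - apply Z.gcd_div_gcd; [exact Hg | reflexivity].
Qed.

Lemma residues_mod_8 (x : Z) :
  x mod 8 = 0 \/ x mod 8 = 1 \/ x mod 8 = 2 \/ x mod 8 = 3 \/
  x mod 8 = 4 \/ x mod 8 = 5 \/ x mod 8 = 6 \/ x mod 8 = 7.
Proof. pose proof (Z.mod_pos_bound x 8). lia. Qed.

(** Squares are 0, 1 or 4 mod 8, and [x], [y] are not both even. *)
Lemma primitive_sum_mod_8 (x y : Z) :
  Z.gcd x y = 1 ->
  (x ^ 2 + y ^ 2) mod 8 = 1 \/ (x ^ 2 + y ^ 2) mod 8 = 2 \/ (x ^ 2 + y ^ 2) mod 8 = 5.
Proof.
  intros Hg.
  assert (Hodd : ~ (x mod 2 = 0 /\ y mod 2 = 0)).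
  { intros [Hx Hy].
    assert (H : (2 | Z.gcd x y)) by
      (apply Z.gcd_greatest; apply Z.mod_divide;
       (exact Hx || exact Hy || discriminate)).
    rewrite Hg in H. apply Z.divide_1_r in H. lia. }
  rewrite Z.add_mod, <- (Z.mod_pow_l x), <- (Z.mod_pow_l y) by lia.
  destruct (residues_mod_8 x) as [Hx|[Hx|[Hx|[Hx|[Hx|[Hx|[Hx|Hx]]]]]]],
    (residues_mod_8 y) as [Hy|[Hy|[Hy|[Hy|[Hy|[Hy|[Hy|Hy]]]]]]];
    rewrite Hx, Hy; cbn; auto;
  exfalso; apply Hodd; split; Z.to_euclidean_division_equations; lia.
Qed.

(** What the descent needs in order to continue with a smaller modulus: either [e]
    or [e / 2] is again congruent to 3 mod 4. *)
Lemma cofactor_mod_8 (d e : Z) :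
  d mod 4 = 3 ->
  (d * e) mod 8 = 1 \/ (d * e) mod 8 = 2 \/ (d * e) mod 8 = 5 ->
  e mod 4 = 3 \/ e mod 8 = 6.
Proof.
  intros Hd. rewrite Z.mul_mod by lia.
  assert (Hd8 : d mod 8 = 3 \/ d mod 8 = 7)
    by (Z.to_euclidean_division_equations; lia).
  assert (He4 : e mod 4 = (e mod 8) mod 4)
    by (Z.to_euclidean_division_equations; lia).
  rewrite He4.
  destruct Hd8 as [-> | ->],
    (residues_mod_8 e) as [He|[He|[He|[He|[He|[He|[He|He]]]]]]];
    rewrite He; cbn; lia.
Qed.

Lemma half_of_6_mod_8 (e : Z) :
  e mod 8 = 6 -> exists e', e = 2 * e' /\ e' mod 4 = 3.
Proof.
  intros He. exists (e / 2). Z.to_euclidean_division_equations; lia.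
Qed.

(** Descent on [d].  Reducing [x] and [y] modulo [d] to absolute value at most
    [d / 2], and then dividing out their gcd, which is coprime to [d], gives a
    primitive sum of two squares [d * e] with [e < d].  By [cofactor_mod_8] one of
    [e], [e / 2] is congruent to 3 mod 4, and it divides the same primitive sum. *)
Lemma no_3_mod_4_divisor_of_primitive_sum (d : Z) :
  0 < d -> d mod 4 = 3 ->
  forall x y, Z.gcd x y = 1 -> ~ (d | x ^ 2 + y ^ 2).
Proof.
  induction d as [d IH] using (well_founded_induction (Zwf_well_founded 0)).
  intros Hd Hd4 x y Hxy Hdiv.
  destruct (centered_residue d x Hd) as [k Hk], (centered_residue d y Hd) as [l Hl].
  set (x1 := x - d * k) in *. set (y1 := y - d * l) in *.
  assert (Hcommon : forall c, (c | d) -> (c | x1) -> (c | y1) -> (c | 1)).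
  { intros c Hc Hcx Hcy. rewrite <- Hxy.
    apply Z.gcd_greatest.
    - replace x with (x1 + d * k) by (unfold x1; ring).
      apply Z.divide_add_r; [exact Hcx | now apply Z.divide_mul_l].
    - replace y with (y1 + d * l) by (unfold y1; ring).
      apply Z.divide_add_r; [exact Hcy | now apply Z.divide_mul_l]. }
  assert (Hdiv1 : (d | x1 ^ 2 + y1 ^ 2)).
  { replace (x1 ^ 2 + y1 ^ 2)
      with (x ^ 2 + y ^ 2 + d * (d * k ^ 2 - 2 * x * k + (d * l ^ 2 - 2 * y * l)))
      by (unfold x1, y1; ring).
    apply Z.divide_add_r; [exact Hdiv | apply Z.divide_factor_l]. }
  assert (Hnz : ~ (x1 = 0 /\ y1 = 0)).
  { intros [Hx0 Hy0].
    assert (H : (d | 1)) by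
      (apply Hcommon; [apply Z.divide_refl | rewrite Hx0 | rewrite Hy0]; apply Z.divide_0_r).
    apply Z.divide_1_r in H. destruct H as [H | H]; subst d; [discriminate | lia]. }
  destruct (factor_gcd x1 y1 Hnz) as (x2 & y2 & Hx2 & Hy2 & Hg2).
  pose proof (Z.gcd_nonneg x1 y1) as Hg0.
  assert (Hgnz : Z.gcd x1 y1 <> 0) by (rewrite Z.gcd_eq_0; exact Hnz).
  assert (Hdg : Z.gcd d (Z.gcd x1 y1) = 1).
  { apply Z.divide_1_r_nonneg; [apply Z.gcd_nonneg |].
    apply Hcommon; [apply Z.gcd_divide_l | | ];
      (eapply Z.divide_trans; [apply Z.gcd_divide_r |]);
      [apply Z.gcd_divide_l | apply Z.gcd_divide_r]. }
  set (g := Z.gcd x1 y1) in *. clearbody g.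
  assert (Hdiv2 : (d | x2 ^ 2 + y2 ^ 2)).
  { apply (Z.gauss d g); [apply (Z.gauss d g) |]; try exact Hdg.
    replace (g * (g * (x2 ^ 2 + y2 ^ 2))) with (x1 ^ 2 + y1 ^ 2)
      by (rewrite Hx2, Hy2; ring).
    exact Hdiv1. }
  destruct Hdiv2 as [e He]. rewrite Z.mul_comm in He.
  pose proof (primitive_sum_mod_8 x2 y2 Hg2) as Hmod.
  assert (Hpos : 0 < x2 ^ 2 + y2 ^ 2).
  { pose proof (Z.square_nonneg x2) as Sx. pose proof (Z.square_nonneg y2) as Sy.
    destruct (Z.eq_dec (x2 ^ 2 + y2 ^ 2) 0) as [H0 | H0]; [| rewrite !Z.pow_2_r in *; lia].
    rewrite H0 in Hmod. cbn in Hmod. lia. }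
  rewrite He in Hmod, Hpos.
  assert (He0 : 0 < e) by (apply (Z.mul_pos_cancel_l d); assumption).
  assert (Hed : e < d).
  { assert (Hx21 : x2 ^ 2 <= x1 ^ 2) by (rewrite Hx2; apply square_le_scaled; lia).
    assert (Hy21 : y2 ^ 2 <= y1 ^ 2) by (rewrite Hy2; apply square_le_scaled; lia).
    apply square_le_of_half_abs in Hk, Hl.
    assert (Hde : 2 * (d * e) <= d * d) by (clear - He Hx21 Hy21 Hk Hl; lia).
    clear - Hd He0 Hde. nia. }
  destruct (cofactor_mod_8 d e Hd4 Hmod) as [He4 | He8].
  - apply (IH e) with (x := x2) (y := y2); try assumption.
    + unfold Zwf; lia.
    + rewrite He. apply Z.divide_factor_r.
  - destruct (half_of_6_mod_8 e He8) as (e' & He2 & He4).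
    assert (He'0 : 0 < e' < d) by (clear - He2 He0 Hed; lia).
    apply (IH e') with (x := x2) (y := y2); try assumption; try apply He'0.
    + unfold Zwf; clear - He'0 Hd; lia.
    + rewrite He, He2. exists (d * 2). ring.
Qed.

(** In [d * e = g ^ 2 * (x' ^ 2 + y' ^ 2)] with [x'], [y'] coprime, let
    [h = gcd d g].  As [d] is coprime to [e], all of [h ^ 2] lies in [d], so
    [d = h ^ 2 * q].  Then [q] is still congruent to 3 mod 4, and being coprime
    to [g / h] it divides the primitive sum. *)
Lemma not_sum_of_two_squares_of_coprime_divisor (d e : Z) :
  0 < d -> d mod 4 = 3 -> Z.gcd d e = 1 -> ~ sum_of_two_squares (d * e).
Proof.
  intros Hd Hd4 Hde (x & y & Hn).
  assert (Hnz : ~ (x = 0 /\ y = 0)).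
  { intros [-> ->]. assert (e = 0) by nia. subst e.
    rewrite Z.gcd_0_r in Hde. assert (d = 1) by lia. subst d. discriminate. }
  destruct (factor_gcd x y Hnz) as (x' & y' & Hx & Hy & Hxy).
  set (g := Z.gcd x y) in *. clearbody g.
  assert (Hn' : d * e = g * g * (x' ^ 2 + y' ^ 2)) by (rewrite Hn, Hx, Hy; ring).
  destruct (factor_gcd d g ltac:(lia)) as (d' & g' & Hd' & Hg' & Hdg').
  pose proof (Z.gcd_divide_l d g) as Hhd.
  pose proof (Z.gcd_nonneg d g) as Hh0.
  set (h := Z.gcd d g) in *. clearbody h.
  assert (Hh : 0 < h) by (destruct (Z.eq_dec h 0) as [-> | Hnz']; lia).
  (* Cancel [h] once, so that [h] divides [d'] by coprimality with [e]. *)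
  assert (Hd'e : d' * e = h * (g' * g' * (x' ^ 2 + y' ^ 2))).
  { apply (Z.mul_reg_l _ _ h); [lia |].
    replace (h * (d' * e)) with (d * e) by (rewrite Hd'; ring).
    rewrite Hn', Hg'. ring. }
  assert (Hhe : Z.gcd h e = 1).
  { apply Z.divide_1_r_nonneg; [apply Z.gcd_nonneg |]. rewrite <- Hde.
    apply Z.gcd_greatest; [| apply Z.gcd_divide_r].
    eapply Z.divide_trans; [apply Z.gcd_divide_l | exact Hhd]. }
  assert (Hhd' : (h | d')).
  { apply (Z.gauss h e); [| exact Hhe].
    exists (g' * g' * (x' ^ 2 + y' ^ 2)).
    rewrite Z.mul_comm, Hd'e. ring. }
  destruct Hhd' as [q Hq].
  assert (Hqe : q * e = g' * g' * (x' ^ 2 + y' ^ 2)).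
  { apply (Z.mul_reg_l _ _ h); [lia |]. rewrite <- Hd'e, Hq. ring. }
  assert (Hqg : Z.gcd q g' = 1).
  { apply Z.divide_1_r_nonneg; [apply Z.gcd_nonneg |]. rewrite <- Hdg'.
    apply Z.gcd_greatest; [| apply Z.gcd_divide_r].
    rewrite Hq. apply Z.divide_mul_l, Z.gcd_divide_l. }
  assert (Hdh : d = h * h * q) by (rewrite Hd', Hq; ring).
  apply (no_3_mod_4_divisor_of_primitive_sum q) with (x := x') (y := y').
  - apply (Z.mul_pos_cancel_l (h * h)); [clear - Hh; nia | rewrite <- Hdh; exact Hd].
  - rewrite Hdh in Hd4.
    assert (Hh2 : (h * h) mod 4 = 0 \/ (h * h) mod 4 = 1).
    { rewrite Z.mul_mod by lia.
      assert (H : h mod 4 = 0 \/ h mod 4 = 1 \/ h mod 4 = 2 \/ h mod 4 = 3)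
        by (pose proof (Z.mod_pos_bound h 4); lia).
      destruct H as [H | [H | [H | H]]]; rewrite H; cbn; auto. }
    rewrite Z.mul_mod in Hd4 by lia.
    destruct Hh2 as [H | H]; rewrite H in Hd4.
    + discriminate.
    + rewrite Z.mul_1_l, Z.mod_mod in Hd4 by lia. exact Hd4.
  - exact Hxy.
  - apply (Z.gauss q g'); [apply (Z.gauss q g') |]; try exact Hqg.
    exists e. rewrite (Z.mul_comm e), Hqe. ring.
Qed.

(** If [x ^ 2 + y ^ 2] is even, then so is [x + y], and the halves of [x + y] and
    [x - y] are the new terms. *)
Lemma sum_of_two_squares_half (n : Z) :
  sum_of_two_squares (2 * n) -> sum_of_two_squares n.
Proof.
  intros (x & y & H).
  destruct (Z.Even_or_Odd (x + y)) as [[s Hs] | [s Hs]].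
  - assert (Hx : x = 2 * s - y) by lia. subst x.
    exists s, (s - y). nia.
  - assert (Hx : x = 2 * s + 1 - y) by lia. subst x. lia.
Qed.

Lemma sum_of_two_squares_nonneg (n : Z) : sum_of_two_squares n -> 0 <= n.
Proof.
  intros (x & y & ->). rewrite !Z.pow_2_r.
  pose proof (Z.square_nonneg x). pose proof (Z.square_nonneg y). lia.
Qed.

Lemma sum_of_two_squares_double (n : Z) :
  sum_of_two_squares n -> sum_of_two_squares (2 * n).
Proof. intros (x & y & ->). exists (x + y), (x - y). ring. Qed.

Lemma not_sum_of_two_squares_3_mod_4 (n : Z) : n mod 4 = 3 -> ~ sum_of_two_squares n.
Proof.
  intros H4 Hn. pose proof (sum_of_two_squares_nonneg n Hn) as H0.
  assert (n <> 0) by (intros ->; discriminate).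
  rewrite <- (Z.mul_1_r n) in Hn. revert Hn.
  apply not_sum_of_two_squares_of_coprime_divisor; [lia | exact H4 | apply Z.gcd_1_r].
Qed.

(** * Doubling *)

(** Subtracting the powers of 2 isolates the question about two squares.  Ordering
    the exponents puts the only possible odd power in second place. *)
Lemma two_squares_two_powers_iff (n : Z) :
  two_squares_two_powers n <->
  sum_of_two_squares n \/
  (exists a, 0 <= a /\ sum_of_two_squares (n - 2 ^ a)) \/
  (exists a b, 0 <= b <= a /\ sum_of_two_squares (n - (2 ^ a + 2 ^ b))).
Proof.
  split; (intros [H | [H | H]]; [now left | right; left | right; right]).
  - destruct H as (x & y & a & Ha & H). exists a. split; [exact Ha |].
    exists x, y. lia.
  - destruct H as (x & y & a & b & Ha & Hb & H).
    destruct (Z.le_ge_cases b a); [exists a, b | exists b, a];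
      (split; [lia |]); exists x, y; lia.
  - destruct H as (a & Ha & x & y & H). exists x, y, a. lia.
  - destruct H as (a & b & Hab & x & y & H). exists x, y, a, b. lia.
Qed.

Lemma two_squares_two_powers_double (n : Z) :
  two_squares_two_powers n -> two_squares_two_powers (2 * n).
Proof.
  rewrite !two_squares_two_powers_iff.
  intros [H | [(a & Ha & H) | (a & b & Hab & H)]]; apply sum_of_two_squares_double in H.
  - now left.
  - right; left. exists (Z.succ a). split; [lia |].
    rewrite Z.pow_succ_r by lia. now rewrite <- Z.mul_sub_distr_l.
  - right; right. exists (Z.succ a), (Z.succ b). split; [lia |].
    rewrite !Z.pow_succ_r by lia.
    now rewrite <- Z.mul_add_distr_l, <- Z.mul_sub_distr_l.
Qed.

Lemma pow2_pred (a : Z) : 0 < a -> 2 ^ a = 2 * 2 ^ (a - 1).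
Proof. intros Ha. rewrite <- Z.pow_succ_r by lia. f_equal. lia. Qed.

(** Take [2 n = x ^ 2 + y ^ 2 + 2 ^ a + 2 ^ b] with [b <= a]; for [b > 0] it halves
    to a representation of [n].  For [b = 0], the case [a = 0] also halves and
    leaves one power [2 ^ 0] for [n], while [a >= 2] makes the sum of squares
    congruent to 3 mod 4.  The case [a = 1] leaves [2 n - 3], and since 9 divides
    [n], this is 3 times a number prime to 3. *)
Lemma not_two_squares_two_powers_double (n : Z) :
  (18 | n) -> ~ two_squares_two_powers n -> ~ two_squares_two_powers (2 * n).
Proof.
  intros [k Hk] Hn. rewrite two_squares_two_powers_iff in Hn |- *.
  intros [H | [(a & Ha & H) | (a & b & Hab & H)]].
  - apply Hn. left. now apply sum_of_two_squares_half.
  - destruct (Z.eq_dec a 0) as [-> | Ha0].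
    + revert H. apply not_sum_of_two_squares_3_mod_4.
      subst n. change (2 ^ 0) with 1. Z.to_euclidean_division_equations; lia.
    + apply Hn. right; left. exists (a - 1). split; [lia |].
      apply sum_of_two_squares_half.
      now rewrite Z.mul_sub_distr_l, <- pow2_pred by lia.
  - destruct (Z.eq_dec b 0) as [-> | Hb0].
    + change (2 ^ 0) with 1 in H.
      assert (C : a = 0 \/ a = 1 \/ 2 <= a) by lia.
      destruct C as [-> | [-> | Ha2]].
      * apply Hn. right; left. exists 0. split; [lia |].
        apply sum_of_two_squares_half.
        replace (2 * (n - 2 ^ 0)) with (2 * n - (2 ^ 0 + 1))
          by (change (2 ^ 0) with 1; lia).
        exact H.
      * replace (2 * n - (2 ^ 1 + 1)) with (3 * (12 * k - 1)) in H
          by (change (2 ^ 1) with 2; lia).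
        revert H. apply not_sum_of_two_squares_of_coprime_divisor; [lia | reflexivity |].
        rewrite <- (Z.gcd_add_mult_diag_r 3 _ (- (4 * k))).
        replace (12 * k - 1 + - (4 * k) * 3) with (- 1) by ring. reflexivity.
      * revert H. apply not_sum_of_two_squares_3_mod_4.
        rewrite pow2_pred, (pow2_pred (a - 1)) by lia. subst n.
        Z.to_euclidean_division_equations; lia.
    + apply Hn. right; right. exists (a - 1), (b - 1). split; [lia |].
      apply sum_of_two_squares_half.
      now rewrite Z.mul_sub_distr_l, Z.mul_add_distr_l, <- !pow2_pred by lia.
Qed.

(** * Finitely many powers of 2 *)

(** The sums of at most two powers of 2 with exponents up to [L].  A single power
    [2 ^ a] with [a > 0] is the pair [2 ^ (a - 1) + 2 ^ (a - 1)], so only 0 and 1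
    stand apart. *)
Definition pow2_sums (L : nat) : list Z :=
  0 :: 1 ::
  flat_map (fun a => map (fun b => 2 ^ Z.of_nat a + 2 ^ Z.of_nat b) (seq 0 (S a)))
    (seq 0 (S L)).

Lemma in_pow2_sums_pair (L : nat) (a b : Z) :
  0 <= b <= a -> a <= Z.of_nat L -> In (2 ^ a + 2 ^ b) (pow2_sums L).
Proof.
  intros Hab HaL. right; right. apply in_flat_map. exists (Z.to_nat a).
  split; [apply in_seq; lia |].
  apply in_map_iff. exists (Z.to_nat b).
  split; [now rewrite !Z2Nat.id by lia | apply in_seq; lia].
Qed.

Lemma two_squares_two_powers_of_pow2_sums (L : nat) (n t : Z) :
  In t (pow2_sums L) -> sum_of_two_squares (n - t) -> two_squares_two_powers n.
Proof.
  rewrite two_squares_two_powers_iff. intros [<- | [<- | Ht]] H.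
  - left. now rewrite Z.sub_0_r in H.
  - right; left. exists 0. split; [lia | exact H].
  - apply in_flat_map in Ht. destruct Ht as (a & _ & Ht).
    apply in_map_iff in Ht. destruct Ht as (b & <- & Hb). apply in_seq in Hb.
    right; right. exists (Z.of_nat a), (Z.of_nat b). split; [lia | exact H].
Qed.

Lemma pow2_sums_of_two_squares_two_powers (L : nat) (n : Z) :
  n < 2 ^ Z.of_nat (S L) -> two_squares_two_powers n ->
  exists t, In t (pow2_sums L) /\ sum_of_two_squares (n - t).
Proof.
  intros HL H. apply two_squares_two_powers_iff in H.
  assert (Hsmall : forall a, 0 <= a -> 2 ^ a <= n -> a <= Z.of_nat L).
  { intros a Ha Han. assert (a < Z.of_nat (S L)); [| lia].
    apply (Z.pow_lt_mono_r_iff 2); lia. }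
  destruct H as [H | [(a & Ha & H) | (a & b & Hab & H)]].
  - exists 0. split; [now left | now rewrite Z.sub_0_r].
  - exists (2 ^ a). split; [| exact H].
    apply sum_of_two_squares_nonneg in H.
    pose proof (Hsmall a Ha ltac:(lia)).
    destruct (Z.eq_dec a 0) as [-> | Ha0]; [right; now left |].
    replace (2 ^ a) with (2 ^ (a - 1) + 2 ^ (a - 1)) by (rewrite (pow2_pred a); lia).
    apply in_pow2_sums_pair; lia.
  - exists (2 ^ a + 2 ^ b). split; [| exact H].
    apply sum_of_two_squares_nonneg in H.
    pose proof (Z.pow_pos_nonneg 2 b ltac:(lia) ltac:(lia)).
    apply in_pow2_sums_pair; [lia | apply Hsmall; lia].
Qed.

(** * Certified failures *)

(** The case of the certificate in which [d] is the whole odd part, which can be too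
    large to be listed. *)
Fixpoint odd_part_3_mod_4 (p : positive) : bool :=
  match p with
  | xO q => odd_part_3_mod_4 q
  | xI (xI _) => true
  | _ => false
  end.

(** [D] is a list of candidates for the divisor [d]. *)
Definition obstructed (D : list Z) (n : Z) : bool :=
  match n with
  | Zneg _ => true
  | Z0 => false
  | Zpos p =>
      odd_part_3_mod_4 p ||
      existsb
        (fun d =>
           (0 <? d) && (d mod 4 =? 3) && (n mod d =? 0) && (Z.gcd d (n / d) =? 1))
        D
  end.

Lemma odd_part_3_mod_4_sound (p : positive) :
  odd_part_3_mod_4 p = true -> ~ sum_of_two_squares (Zpos p).
Proof.
  induction p as [[q | q |] _ | p IH |]; cbn; try discriminate; intros H.
  - apply not_sum_of_two_squares_3_mod_4.
    change (Zpos q~1~1) with (2 * (2 * Zpos q + 1) + 1).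
    Z.to_euclidean_division_equations; lia.
  - intros Hp. apply (IH H). now apply sum_of_two_squares_half.
Qed.

Lemma obstructed_sound (D : list Z) (n : Z) :
  obstructed D n = true -> ~ sum_of_two_squares n.
Proof.
  destruct n as [| p | p]; cbn -[Z.modulo Z.div Z.gcd]; [discriminate | |].
  - rewrite orb_true_iff. intros [H | H]; [now apply odd_part_3_mod_4_sound |].
    apply existsb_exists in H. destruct H as (d & _ & H).
    rewrite !andb_true_iff, !Z.eqb_eq, Z.ltb_lt in H.
    destruct H as [[[Hd H4] Hmod] Hgcd].
    rewrite (Z_div_exact_full_2 (Zpos p) d) by lia.
    now apply not_sum_of_two_squares_of_coprime_divisor.
  - intros _ H. apply sum_of_two_squares_nonneg in H. lia.
Qed.

Lemma not_two_squares_two_powers_of_obstructed (D : list Z) (L : nat) (n : Z) :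
  n < 2 ^ Z.of_nat (S L) ->
  forallb (fun t => obstructed D (n - t)) (pow2_sums L) = true ->
  ~ two_squares_two_powers n.
Proof.
  intros HL H Hn.
  destruct (pow2_sums_of_two_squares_two_powers L n HL Hn) as (t & Ht & Hs).
  rewrite forallb_forall in H. exact (obstructed_sound _ _ (H t Ht) Hs).
Qed.

(** Any list containing a divisor for each difference works; this one was picked
    greedily, by how many differences a divisor settles. *)
Lemma not_two_squares_two_powers_535903 : ~ two_squares_two_powers 535903.
Proof.
  apply (not_two_squares_two_powers_of_obstructed
    (3 :: 7 :: 11 :: 19 :: 23 :: 27 :: 31 :: 71 :: 419 :: nil) 19).
  - reflexivity.
  - vm_compute. reflexivity.
Qed.

Lemma not_two_squares_two_powers_1151121374334 :
  ~ two_squares_two_powers 1151121374334.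
Proof.
  apply (not_two_squares_two_powers_of_obstructed
    (3 :: 7 :: 11 :: 19 :: 23 :: 27 :: 31 :: 43 :: 47 :: 59 :: 67 :: 71 :: 79 :: 103 ::
     163 :: 359 :: 431 :: 727 :: 1423 :: 1699 :: 2187 :: 5623 :: 10651 :: 13751 ::
     16363 :: 29527 :: 30839 :: 32587 :: 98011 :: 136943 :: 213307 :: nil) 40).
  - reflexivity.
  - vm_compute. reflexivity.
Qed.

Lemma not_two_squares_two_powers_family (alpha : Z) :
  0 <= alpha -> ~ two_squares_two_powers (2 ^ alpha * 1151121374334).
Proof.
  revert alpha. apply natlike_ind.
  - exact not_two_squares_two_powers_1151121374334.
  - intros alpha Ha IH. rewrite Z.pow_succ_r, <- Z.mul_assoc by exact Ha.
    apply not_two_squares_two_powers_double; [| exact IH].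
    apply Z.divide_mul_r. exists (1151121374334 / 18). reflexivity.
Qed.

(** * Representing the numbers below 535903 *)

Definition add_up_to (M : positive) (s t : Z) (T : PositiveSet.t) : PositiveSet.t :=
  match s + t with
  | Zpos p => if (M <? p)%positive then T else PositiveSet.add p T
  | _ => T
  end.

Definition sumset (M : positive) (l1 l2 : list Z) : PositiveSet.t :=
  fold_right (fun s T => fold_right (add_up_to M s) T l2) PositiveSet.empty l1.

Fixpoint squares_desc (B : nat) : list Z :=
  match B with
  | O => nil
  | S x => Z.of_nat x ^ 2 :: squares_desc x
  end.

(** Written with [if], here and below, because a boolean disjunction would evaluate
    the rest of the list under call by value, even after a hit. *)
Fixpoint meets_shifted (T : PositiveSet.t) (n : Z) (l : list Z) : bool :=
  match l with
  | nil => false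
  | s :: l' =>
      if match n - s with Zpos p => PositiveSet.mem p T | _ => false end
      then true else meets_shifted T n l'
  end.

Fixpoint check_range (f : Z -> bool) (k : nat) (n : Z) : bool :=
  match k with
  | O => true
  | S k' => if f n then check_range f k' (n + 1) else false
  end.

(** For [l = squares_desc (x + 1)] the head is [x ^ 2] and the tail has length [x],
    so that the range tested is the gap from [x ^ 2] up to [(x + 1) ^ 2].  The
    squares that can be subtracted from a number in this gap are exactly those
    in [l]. *)
Fixpoint check_gaps (N : Z) (T : PositiveSet.t) (l : list Z) : bool :=
  match l with
  | nil => true
  | s :: l' =>
      if check_range
           (fun n =>
              if Z.even n then true else
              if N <=? n then true else meets_shifted T n l)
           (S (2 * length l')) s
      then check_gaps N T l' else false
  end.

Lemma in_fold_add_up_to (M : positive) (s : Z) (l : list Z) (T : PositiveSet.t)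
    (p : positive) :
  PositiveSet.In p (fold_right (add_up_to M s) T l) ->
  PositiveSet.In p T \/ exists t, In t l /\ Zpos p = s + t.
Proof.
  induction l as [| t l IH]; cbn [fold_right]; [now left |].
  assert (Hlift : PositiveSet.In p T \/ (exists u, In u l /\ Zpos p = s + u) ->
                  PositiveSet.In p T \/ (exists u, In u (t :: l) /\ Zpos p = s + u)).
  { intros [H | (u & Hu & H)]; [now left |].
    right. exists u. split; [now right | exact H]. }
  unfold add_up_to at 1. intros Hp.
  destruct (s + t) as [| r | r] eqn:Hst; [now apply Hlift, IH | | now apply Hlift, IH].
  destruct (M <? r)%positive; [now apply Hlift, IH |].
  apply PositiveSet.add_spec in Hp. destruct Hp as [-> | Hp]; [| now apply Hlift, IH].
  right. exists t. split; [now left | now symmetry].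
Qed.

Lemma in_sumset (M : positive) (l1 l2 : list Z) (p : positive) :
  PositiveSet.In p (sumset M l1 l2) ->
  exists s t, In s l1 /\ In t l2 /\ Zpos p = s + t.
Proof.
  unfold sumset. induction l1 as [| s l1 IH]; cbn [fold_right]; intros Hp.
  - now apply PositiveSet.empty_spec in Hp.
  - apply in_fold_add_up_to in Hp. destruct Hp as [Hp | (t & Ht & Hp)].
    + destruct (IH Hp) as (u & t & Hu & Ht & Hut).
      exists u, t. split; [now right | now split].
    + exists s, t. split; [now left | now split].
Qed.

Lemma in_squares_desc (B : nat) (s : Z) : In s (squares_desc B) -> exists x, s = x ^ 2.
Proof.
  induction B as [| x IH]; cbn [squares_desc In]; [easy |].
  intros [<- | Hs]; [now exists (Z.of_nat x) | exact (IH Hs)].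
Qed.

Lemma length_squares_desc (B : nat) : length (squares_desc B) = B.
Proof. induction B as [| x IH]; cbn [squares_desc length]; congruence. Qed.

Lemma meets_shifted_sound (T : PositiveSet.t) (n : Z) (l : list Z) :
  meets_shifted T n l = true ->
  exists s p, In s l /\ PositiveSet.In p T /\ n = s + Zpos p.
Proof.
  induction l as [| s l IH]; cbn [meets_shifted]; [discriminate |].
  destruct (n - s) as [| p | p] eqn:Hns.
  2: destruct (PositiveSet.mem p T) eqn:Hp.
  2: { intros _. exists s, p. split; [now left | split; [exact Hp | lia]]. }
  all: intros H; destruct (IH H) as (u & r & Hu & Hr); exists u, r.
  all: split; [now right | exact Hr].
Qed.

Lemma check_range_sound (f : Z -> bool) (k : nat) (n m : Z) :
  check_range f k n = true -> n <= m < n + Z.of_nat k -> f m = true.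
Proof.
  revert n. induction k as [| k IH]; intros n; cbn [check_range]; [lia |].
  destruct (f n) eqn:Hn; [| discriminate]. intros Hk Hm.
  destruct (Z.eq_dec m n) as [-> | Hmn]; [exact Hn |].
  apply (IH (n + 1) Hk). lia.
Qed.

Lemma check_gaps_sound (N : Z) (T : PositiveSet.t) (B : nat) (n : Z) :
  check_gaps N T (squares_desc B) = true ->
  Z.even n = false -> 0 <= n < N -> n < Z.of_nat B ^ 2 ->
  exists x p, PositiveSet.In p T /\ n = x ^ 2 + Zpos p.
Proof.
  intros Hc Heven HN. induction B as [| x IH]; [cbn; lia |].
  cbn [squares_desc check_gaps] in Hc. rewrite length_squares_desc in Hc.
  destruct (check_range _ _ _) eqn:Hr in Hc; [| discriminate].
  intros HB. destruct (Z.lt_ge_cases n (Z.of_nat x ^ 2)) as [Hlt | Hge]; [now apply IH |].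
  apply (check_range_sound _ _ _ n) in Hr.
  - cbv beta in Hr. rewrite Heven, (proj2 (Z.leb_gt N n)) in Hr by lia.
    apply meets_shifted_sound in Hr. destruct Hr as (s & p & Hs & Hp & Hn).
    apply (in_squares_desc (S x)) in Hs. destruct Hs as [y ->]. now exists y, p.
  - rewrite Nat2Z.inj_succ, Z.pow_2_r in HB. rewrite Z.pow_2_r in Hge |- *. lia.
Qed.

(** The parameters are kept abstract here, so that type checking never tries to
    unfold the large computation; it is run once, when they are instantiated. *)
Lemma two_squares_two_powers_odd_of_check (M : positive) (N : Z) (L A B : nat) (n : Z) :
  (let T := sumset M (pow2_sums L) (squares_desc A) in
   check_gaps N T (squares_desc B)) = true ->
  Z.even n = false -> 0 <= n < N -> n < Z.of_nat B ^ 2 -> two_squares_two_powers n.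
Proof.
  cbv zeta. intros Hc Heven HN HB.
  destruct (check_gaps_sound _ _ _ _ Hc Heven HN HB) as (x & p & Hp & Hn).
  apply in_sumset in Hp. destruct Hp as (t & s & Ht & Hs & Hp).
  apply in_squares_desc in Hs. destruct Hs as [y ->].
  apply (two_squares_two_powers_of_pow2_sums L n t Ht).
  exists x, y. lia.
Qed.

(** The square [733 ^ 2 = 537289] is the first above 535903.  When the squares are
    subtracted from the largest down, 201606 is the largest difference [n - x ^ 2]
    at which the search first succeeds for some [n].  Below it, [2 ^ 17] is the
    largest power of 2 and [449 ^ 2] the largest square. *)
Lemma two_squares_two_powers_odd (n : Z) :
  Z.even n = false -> 0 <= n < 535903 -> two_squares_two_powers n.
Proof.
  intros Heven Hn.
  apply (two_squares_two_powers_odd_of_check 201606 535903 17 450 733);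
    [| exact Heven | exact Hn | ].
  - vm_cast_no_check (eq_refl true).
  - change (Z.of_nat 733 ^ 2) with 537289. lia.
Qed.

(** Halving stays above 1 until it meets an odd number, except for 2, the double of
    [1 = 1 ^ 2 + 0 ^ 2]. *)
Lemma two_squares_two_powers_small (n : Z) :
  1 < n < 535903 -> two_squares_two_powers n.
Proof.
  induction n as [n IH] using (well_founded_induction (Zwf_well_founded 0)).
  intros Hn. destruct (Z.even n) eqn:Heven;
    [| apply two_squares_two_powers_odd; [exact Heven | lia]].
  apply Z.even_spec in Heven. destruct Heven as [k ->].
  apply two_squares_two_powers_double.
  destruct (Z.eq_dec k 1) as [-> | Hk1].
  - left. exists 1, 0. reflexivity.
  - apply IH; [unfold Zwf |]; lia.
Qed.

(** * The theorem *)

Theorem theorem1 :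
  is_smallest (fun n : Z => 1 < n /\ ~ two_squares_two_powers n) 535903 /\
  (forall alpha : Z, 0 <= alpha ->
     ~ two_squares_two_powers (2 ^ alpha * 1151121374334)).
Proof.
  split; [split |].
  - split; [reflexivity | exact not_two_squares_two_powers_535903].
  - intros n [Hn H]. apply Z.nlt_ge. intros Hlt.
    apply H, two_squares_two_powers_small. lia.
  - exact not_two_squares_two_powers_family.
Qed.
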